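(* Let $(\mathbf{l}_\alpha,\mathbf{l}_\beta,\mathbf{l}_\gamma)$ be the cycle structure of an autotopism of a Latin square of order $n$, and let $\Theta_1=(\alpha_1,\beta_1,\gamma_1)$ and $\Theta_2=(\alpha_2,\beta_2,\gamma_2)$ be elements of $\mathfrak{A}_n$ both having cycle structure $(\mathbf{l}_\alpha,\mathbf{l}_\beta,\mathbf{l}_\gamma)$. Then $\mathcal{P}_{LS(\Theta_1)}$ and $\mathcal{P}_{LS(\Theta_2)}$ are $0/1$-equivalent. Analogously, $\mathcal{P}'_{LS(\Theta_1)}$ and $\mathcal{P}'_{LS(\Theta_2)}$ are $0/1$-equivalent.
   Context: $[n]=\{1,\dots,n\}$ and $S_n$ is the group of permutations of $[n]$. A Latin square of order $n$ is an $n\times n$ array $L=(l_{i,j})$ with entries in $[n]$ such that each symbol occurs exactly once in each row and each column; it is identified with $\{(i,j,l_{i,j}) : i,j\in[n]\}$. For $\Theta=(\alpha,\beta,\gamma)\in S_n^3$, $L^\Theta=\{(\alpha(i),\beta(j),\gamma(l_{i,j})) : i,j\in[n]\}$; $\Theta$ is an autotopism of $L$ if $L^\Theta=L$; $\mathfrak{A}_n$ is the set of all autotopisms of Latin squares of order $n$. The cycle structure of $\delta\in S_n$ is the sequence $\mathbf{l}_\delta$ of length $n$ whose $i$-th term is the number of cycles of length $i$ of $\delta$; the cycle structure of $\Theta=(\alpha,\beta,\gamma)$ is $(\mathbf{l}_\alpha,\mathbf{l}_\beta,\mathbf{l}_\gamma)$. Two $0/1$-polytopes (convex hulls of finite sets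 of $0/1$-vectors) are $0/1$-equivalent if one can be transformed into the other by a sequence of operations, each either permuting coordinates or switching a coordinate (replacing $x_i$ by $1-x_i$). For $\Theta\in\mathfrak{A}_n$, $FS(\Theta)\subseteq\{0,1\}^{n^3}$ is the set of $(x_{ijk})_{i,j,k\in[n]}$ with $x_{ijk}\in\{0,1\}$, $\sum_{i}x_{ijk}=1$ for all $j,k$, $\sum_j x_{ijk}=1$ for all $i,k$, $\sum_k x_{ijk}=1$ for all $i,j$, and $x_{ijk}=x_{\alpha(i)\beta(j)\gamma(k)}$ for all $i,j,k\in[n]$. For $\delta\in S_n$: $Fix(\delta)=\{i\in[n]:\delta(i)=i\}$, $\mathbf{l}_\delta^1=|Fix(\delta)|$, $\mathbf{n}_\delta$ is the number of cycles of $\delta$ (fixed points counted as cycles of length 1), and $S_\delta$ is the set of elements that are the minimum of their cycle of $\delta$. $S_\Theta=\{(i,j): i\in S_\alpha,\ j\in[n] \text{ if } i\notin Fix(\alpha),\ j\in S_\beta\text{ if } i\in Fix(\alpha)\}$. $S_{Fix(\Theta)}$ is the set of triples $(i,j,k)\in[n]^3$ such that one of the following holds: (a) $i\in Fix(\alpha)$, $j\in Fix(\beta)$, $k\notin Fix(\gamma)$; (b) $i\in Fix(\alpha)$, $k\in Fix(\gamma)$, $j\notin Fix(\beta)$; (c) $j\in Fix(\beta)$, $k\in Fix(\gamma)$, $i\notin Fix(\alpha)$. For $s,t\in[n]$: $S^{(1,s,t)}_{Fix(\Theta)}=\{i:(i,s,t)\in S_{Fix(\Theta)}\}$, $S^{(2,s,t)}_{Fix(\Theta)}=\{j:(s,j,t)\in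 S_{Fix(\Theta)}\}$, $S^{(3,s,t)}_{Fix(\Theta)}=\{k:(s,t,k)\in S_{Fix(\Theta)}\}$. For $i,j,k\in[n]$, let $m=m_{i,j}=\min\{t\geq 0: (\alpha^t(i),\beta^t(j))\in S_\Theta\}$, and set $(i_\Theta,j_\Theta,k_\Theta)=(\alpha^m(i),\beta^m(j),\gamma^m(k))$. $FS'(\Theta)$ is the set of $(x_{ijk})$ indexed by $(i,j,k)\in(S_\Theta\times[n])\setminus S_{Fix(\Theta)}$ with $x_{ijk}\in\{0,1\}$ satisfying: $\sum_{i\in[n]\setminus S^{(1,j,k)}_{Fix(\Theta)}}x_{i_\Theta j_\Theta k_\Theta}=1$ for all $j,k\in[n]$; $\sum_{j\in[n]\setminus S^{(2,i,k)}_{Fix(\Theta)}}x_{i_\Theta j_\Theta k_\Theta}=1$ for all $i,k\in[n]$; $\sum_{k\in[n]\setminus S^{(3,i,j)}_{Fix(\Theta)}}x_{i_\Theta j_\Theta k_\Theta}=1$ for all $i,j\in[n]$. The number of variables is $$d_{\Theta}=\big((\mathbf{n}_{\alpha}-\mathbf{l}_{\alpha}^1) n^2 + \mathbf{l}_{\alpha}^1 \mathbf{n}_{\beta} n\big)-\big(\mathbf{l}_{\alpha}^1 \mathbf{l}_{\beta}^1 (n -\mathbf{l}_{\gamma}^1) + \mathbf{l}_{\alpha}^1 \mathbf{l}_{\gamma}^1 (\mathbf{n}_{\beta} -\mathbf{l}_{\beta}^1) + \mathbf{l}_{\beta}^1 \mathbf{l}_{\gamma}^1 (\mathbf{n}_{\alpha}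 -\mathbf{l}_{\alpha}^1)\big),$$ which depends only on the cycle structure of $\Theta$. $\mathcal{P}_{LS(\Theta)}=\operatorname{conv}(FS(\Theta))\subseteq\mathbb{R}^{n^3}$ and $\mathcal{P}'_{LS(\Theta)}=\operatorname{conv}(FS'(\Theta))\subseteq\mathbb{R}^{d_\Theta}$. *)

(* Defs.v *)
From Stdlib Require Export Relation_Operators.
From mathcomp Require Export boolp classical_sets reals convex.
From mathcomp Require Export all_boot all_order all_algebra perm.

Set Implicit Arguments.
Unset Strict Implicit.
Unset Printing Implicit Defensive.

Import Order.TTheory GRing.Theory Num.Theory.

Local Open Scope nat_scope.

(* [n] is represented by 'I_n = {0, ..., n-1}. *)
Notation triple n := ('I_n * 'I_n * 'I_n)%type.
Notation perm3 n := ('S_n * 'S_n * 'S_n)%type.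

Section Autotopisms.
Variable n : nat.
Implicit Types (L : 'M['I_n]_n) (d : 'S_n) (Th : perm3 n).

Definition act3 Th (t : triple n) : triple n :=
  (Th.1.1 t.1.1, Th.1.2 t.1.2, Th.2 t.2).

Definition latin_square L :=
  [forall i, forall k, #|[set j | L i j == k]| == 1] &&
  [forall j, forall k, #|[set i | L i j == k]| == 1].

Definition ls_triples L : {set triple n} :=
  [set (p.1, p.2, L p.1 p.2) | p : 'I_n * 'I_n].

Definition autotopism Th L := act3 Th @: ls_triples L == ls_triples L.

Definition autotopisms : {set perm3 n} :=
  [set Th | [exists L : 'M['I_n]_n, latin_square L && autotopism Th L]].

(* Entry i (counted from 0) is the number of cycles of length i.+1;
   the cycles are the elements of porbits d, fixed points included. *)
Definition cycle_structure d : n.-tuple nat :=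
  [tuple #|[set C in porbits d | #|C| == i.+1]| | i < n].

Definition cycle_structure3 Th : n.-tuple nat * n.-tuple nat * n.-tuple nat :=
  (cycle_structure Th.1.1, cycle_structure Th.1.2, cycle_structure Th.2).

Definition FS Th : {set {ffun triple n -> bool}} :=
  [set x : {ffun triple n -> bool} |
   [&& [forall j, forall k, \sum_(i < n) x (i, j, k) == 1],
       [forall i, forall k, \sum_(j < n) x (i, j, k) == 1],
       [forall i, forall j, \sum_(k < n) x (i, j, k) == 1]
     & [forall t, x t == x (act3 Th t)]]].

Definition fixpts d : {set 'I_n} := [set i | d i == i].

Definition ncycles d : nat := #|porbits d|.

Definition Smin d : {set 'I_n} := [set i : 'I_n | [forall j in porbit d i, i <= j]].

Definition STh Th : {set 'I_n * 'I_n} :=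
  [set p | (p.1 \in Smin Th.1.1) &&
           ((p.1 \in fixpts Th.1.1) ==> (p.2 \in Smin Th.1.2))].

Definition SFix Th : {set triple n} :=
  [set t | let: (i, j, k) := t in
   [|| [&& i \in fixpts Th.1.1, j \in fixpts Th.1.2 & k \notin fixpts Th.2],
       [&& i \in fixpts Th.1.1, k \in fixpts Th.2 & j \notin fixpts Th.1.2]
     | [&& j \in fixpts Th.1.2, k \in fixpts Th.2 & i \notin fixpts Th.1.1]]].

Lemma mem_SFix Th i j k : ((i, j, k) \in SFix Th) =
  [|| [&& i \in fixpts Th.1.1, j \in fixpts Th.1.2 & k \notin fixpts Th.2],
      [&& i \in fixpts Th.1.1, k \in fixpts Th.2 & j \notin fixpts Th.1.2]
    | [&& j \in fixpts Th.1.2, k \in fixpts Th.2 & i \notin fixpts Th.1.1]].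
Proof. by rewrite in_set. Qed.

Definition SFix1 Th (s t : 'I_n) : {set 'I_n} := [set i | (i, s, t) \in SFix Th].
Definition SFix2 Th (s t : 'I_n) : {set 'I_n} := [set j | (s, j, t) \in SFix Th].
Definition SFix3 Th (s t : 'I_n) : {set 'I_n} := [set k | (s, t, k) \in SFix Th].

Lemma Smin_ex d i : exists t, ((d ^+ t)%g i) \in Smin d.
Proof.
have [j /porbitP[t ->] mj] := arg_minnP (fun j : 'I_n => j : nat) (porbit_id d i).
exists t; rewrite inE; apply/forall_inP => k; rewrite porbit_perm; exact: mj.
Qed.

Lemma Fix_perm d t i : ((d ^+ t)%g i \in fixpts d) = (i \in fixpts d).
Proof. by rewrite !inE -!permM -expgSr expgS permM (inj_eq perm_inj). Qed.

Lemma STh_ex Th i j :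
  exists t, ((Th.1.1 ^+ t)%g i, (Th.1.2 ^+ t)%g j) \in STh Th.
Proof.
have [fi|nfi] := boolP (i \in fixpts Th.1.1).
  have [t tj] := Smin_ex Th.1.2 j; exists t.
  rewrite inE /= tj implybT andbT.
  rewrite inE; apply/forall_inP => k; rewrite porbit_perm => /porbitP[s ->].
  have fixE m : (Th.1.1 ^+ m)%g i = i.
    by elim: m => [|m IHm]; rewrite ?perm1// expgSr permM IHm; move: fi; rewrite inE => /eqP.
  by rewrite !fixE.
have [t ti] := Smin_ex Th.1.1 i; exists t.
by rewrite inE /= ti Fix_perm (negPf nfi).
Qed.

Definition mTh Th (i j : 'I_n) : nat := ex_minn (STh_ex Th i j).

(* (i, j, k) |-> (i_Theta, j_Theta, k_Theta) *)
Definition repTh Th (t : triple n) : triple n :=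
  let m := mTh Th t.1.1 t.1.2 in
  ((Th.1.1 ^+ m)%g t.1.1, (Th.1.2 ^+ m)%g t.1.2, (Th.2 ^+ m)%g t.2).

(* (S_Theta x [n]) \ S_{Fix(Theta)} *)
Definition index_set Th : {set triple n} :=
  setX (STh Th) [set: 'I_n] :\: SFix Th.

Definition FS'_coord Th := {t : triple n | t \in index_set Th}.

Lemma rep_index Th t : t \notin SFix Th -> repTh Th t \in index_set Th.
Proof.
case: t => [[i j] k] tF; rewrite in_setD in_setX in_setT andbT.
apply/andP; split; last by rewrite /repTh /mTh /=; case: ex_minnP.
by move: tF; rewrite /repTh !mem_SFix /= !Fix_perm.
Qed.

(* Value of the variable x_t; the default value false is never used in FS'
   because of rep_index. *)
Definition xval Th (x : {ffun FS'_coord Th -> bool}) (t : triple n) : bool :=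
  if insub t is Some u then x u else false.

Definition FS' Th : {set {ffun FS'_coord Th -> bool}} :=
  [set x : {ffun FS'_coord Th -> bool} |
   [&& [forall j, forall k, \sum_(i in ~: SFix1 Th j k) xval x (repTh Th (i, j, k)) == 1],
       [forall i, forall k, \sum_(j in ~: SFix2 Th i k) xval x (repTh Th (i, j, k)) == 1]
     & [forall i, forall j, \sum_(k in ~: SFix3 Th i j) xval x (repTh Th (i, j, k)) == 1]]].

Definition dTh Th : nat :=
  let: (na, nb) := (ncycles Th.1.1, ncycles Th.1.2) in
  let: (la, lb, lc) := (#|fixpts Th.1.1|, #|fixpts Th.1.2|, #|fixpts Th.2|) in
  ((na - la) * n ^ 2 + la * nb * n)
  - (la * lb * (n - lc) + la * lc * (nb - lb) + lb * lc * (na - la)).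

Lemma card_Smin d : #|Smin d| = ncycles d.
Proof.
rewrite /ncycles; have -> : porbits d = [set porbit d i | i in Smin d].
  apply/setP => C; apply/imsetP/imsetP => -[i _ ->]; last by exists i.
  by have [t ti] := Smin_ex d i; exists ((d ^+ t)%g i); rewrite ?porbit_perm.
rewrite card_in_imset // => i j; rewrite !inE => /forall_inP mi /forall_inP mj eij.
apply/val_inj/eqP; rewrite eqn_leq mi ?mj ?eij ?porbit_id //.
by rewrite -eij porbit_id.
Qed.

Lemma Fix_Smin d : fixpts d \subset Smin d.
Proof.
apply/subsetP => i; rewrite !inE => /eqP di.
apply/forall_inP => _ /porbitP[t ->].
by elim: t => [|t IHt]; rewrite ?perm1// expgS permM di.
Qed.

(* The ambient space of FS' Th is thus R^(dTh Th). *)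
Lemma card_FS'_coord Th : #|{: FS'_coord Th}| = dTh Th.
Proof.
rewrite card_sig /dTh -!card_Smin.
set a := Th.1.1; set b := Th.1.2; set c := Th.2.
have cD d : #|Smin d :\: fixpts d| = #|Smin d| - #|fixpts d|.
  by rewrite cardsD (setIidPr (Fix_Smin d)).
have cC d : #|~: fixpts d| = n - #|fixpts d|.
  by rewrite cardsCs setCK card_ord.
set A1 := setX (Smin a :\: fixpts a) [set: 'I_n].
set A2 := setX (fixpts a) (Smin b).
have SE : STh Th = A1 :|: A2.
  apply/setP => -[i j]; rewrite in_set /= !(in_setX, in_setU, in_setD, in_setT) -/a -/b.
  have /subsetP/(_ i) := Fix_Smin a.
  by case: (i \in fixpts a) => [->|_] //=; case: (i \in Smin a).
set B1 := setX (setX (fixpts a) (fixpts b)) (~: fixpts c).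
set B2 := setX (setX (fixpts a) (Smin b :\: fixpts b)) (fixpts c).
set B3 := setX (setX (Smin a :\: fixpts a) (fixpts b)) (fixpts c).
have IE : setX (STh Th) [set: 'I_n] :&: SFix Th = B1 :|: B2 :|: B3.
  apply/setP => -[[i j] k].
  rewrite in_setI mem_SFix SE -/a -/b -/c !(in_setX, in_setU, in_setD, in_setT, in_setI, in_setC).
  have /subsetP/(_ i) := Fix_Smin a; have /subsetP/(_ j) := Fix_Smin b.
  case: (i \in fixpts a); case: (j \in fixpts b); case: (k \in fixpts c);
    case: (i \in Smin a); case: (j \in Smin b) => //= H1 H2 //;
    by [have := H1 isT | have := H2 isT].
have -> : #|[pred t | t \in index_set Th]| = #|index_set Th| by apply: eq_card.
rewrite cardsD IE cardsX SE cardsT card_ord.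
rewrite cardsU (_ : A1 :&: A2 = set0) ?cards0 ?subn0; last first.
  by apply/setP => -[i j]; rewrite !(in_setX, in_setI, in_setD, in_setT, inE); case: (a i == i); rewrite ?andbF.
rewrite cardsU (_ : (B1 :|: B2) :&: B3 = set0) ?cards0 ?subn0; last first.
  apply/setP => -[[i j] k]; rewrite !(in_setX, in_setI, in_setU, in_setD, in_setC, in_set0).
  by case: (i \in fixpts a); rewrite ?andbF.
rewrite cardsU (_ : B1 :&: B2 = set0) ?cards0 ?subn0; last first.
  apply/setP => -[[i j] k]; rewrite !(in_setX, in_setI, in_setU, in_setD, in_setC, in_set0).
  by case: (j \in fixpts b); rewrite ?andbF.
rewrite !cardsX cardsT card_ord !cD cC mulnDl -!mulnA mulnn.
congr (_ - (_ + _ * _ + _)); first by rewrite mulnC.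
by rewrite [RHS]mulnA [RHS]mulnC.
Qed.
End Autotopisms.

Section Polytopes.
Variable R : realType.
Local Open Scope classical_set_scope.
Local Open Scope ring_scope.

(* A polytope in R^d is a subset of {ffun I -> R^o} for a finite type I of
   coordinates with d elements; R^o is R seen as a module over itself. *)
Definition pt01 (I : finType) (x : {ffun I -> bool}) : {ffun I -> R^o} :=
  [ffun i => (x i)%:R].

Definition conv01 (I : finType) (V : {set {ffun I -> bool}}) : set {ffun I -> R^o} :=
  smallest (@convex_set R {ffun I -> R^o}) (@pt01 I @` [set` V]).

Definition reindex (I J : finType) (f : J -> I) (x : {ffun I -> R^o}) : {ffun J -> R^o} :=
  [ffun j => x (f j)].

Definition switch (I : finType) (i0 : I) (x : {ffun I -> R^o}) : {ffun I -> R^o} :=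
  [ffun i => if i == i0 then 1 - x i else x i].

Inductive step01 (I : finType) (P : set {ffun I -> R^o}) : set {ffun I -> R^o} -> Prop :=
| Step_perm (s : {perm I}) : step01 P (reindex s @` P)
| Step_switch (i : I) : step01 P (switch i @` P).

(* The coordinates of P and Q may be indexed by different finite types, e.g.
   for FS' Th1 and FS' Th2: the bijection f identifies the two ambient spaces
   with one R^d.  Which f is used is irrelevant, up to a Step_perm. *)
Definition equiv01 (I J : finType) (P : set {ffun I -> R^o}) (Q : set {ffun J -> R^o}) :=
  exists2 f : J -> I, bijective f &
    clos_refl_trans _ (@step01 J) (reindex f @` P) Q.

Definition P_LS n (Th : perm3 n) : set {ffun triple n -> R^o} :=
  conv01 (FS Th).

Definition P'_LS n (Th : perm3 n) : set {ffun FS'_coord Th -> R^o} :=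
  conv01 (FS' Th).

End Polytopes.

Arguments P_LS R [n] Th.
Arguments P'_LS R [n] Th.

(* Main.v *)
(** A conjugation of [Th1] to [Th2] relabels rows, columns and symbols, hence
    permutes coordinates and carries FS(Th1) to FS(Th2).  The coordinates of
    FS'(Th) depend moreover on the minima of the cycles; permutations with the
    same cycle structure can be conjugated so that the minimum of each cycle is
    sent to the minimum of the corresponding cycle, and such a conjugation also
    respects S_Theta, S_Fix(Theta) and the choice of representatives. *)
Require Import Defs.

Set Implicit Arguments.
Unset Strict Implicit.
Unset Printing Implicit Defensive.

Local Open Scope nat_scope.

(** * Powers of a permutation along a cycle *)

Section PermCycles.
Variables (T : finType) (d : {perm T}).

(** [traject] lists the cycle of [x] without repetition, and the [m]-th power sends [x] to position
    [m] modulo the cycle length. Equalities of powers thus transfer between cycles of equal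
    length. *)
Lemma permX_eq_mod x a b :
  ((d ^+ a)%g x == (d ^+ b)%g x) = (a == b %[mod #|porbit d x|]).
Proof.
set c := #|porbit d x|.
have c0 : 0 < c by rewrite lt0n card_porbit_neq0.
have dc : (d ^+ c)%g x = x by rewrite permX iter_porbit.
have modE m : (d ^+ m)%g x = nth x (traject d x c) (m %% c).
  rewrite nth_traject ?ltn_mod // -permX {1}(divn_eq m c) expgnDr permM.
  by congr (_ _); elim: (m %/ c) => [|k IHk];
    rewrite ?mul0n ?perm1// mulSn expgnDr permM dc.
by rewrite !modE nth_uniq ?size_traject ?ltn_mod// uniq_traject_porbit.
Qed.

End PermCycles.

(** Each fibre of [f] in [A] is matched by rank with the fibre of [g] in [B] over the same value;
    equal cardinalities keep the rank in range, so the default [y0] is never returned on [A]. *)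
Lemma exists_inj_on (S T : finType) (U : eqType) (A : {set S}) (B : {set T})
    (f : S -> U) (g : T -> U) (y0 : T) :
  (forall x, x \in A -> #|[set z in A | f z == f x]| = #|[set y in B | g y == f x]|) ->
  exists h : S -> T, {in A &, injective h} /\
    {in A, forall x, h x \in B /\ g (h x) = f x}.
Proof.
move=> cAB; pose eA u := enum [set z in A | f z == u].
pose eB u := enum [set y in B | g y == u].
pose h x := nth y0 (eB (f x)) (index x (eA (f x))).
have szE x : x \in A -> index x (eA (f x)) < size (eB (f x)).
  by move=> xA; rewrite -cardE -cAB// cardE index_mem mem_enum inE xA eqxx.
have hP x : x \in A -> h x \in B /\ g (h x) = f x.
  move=> xA; have /(mem_nth y0) := szE x xA.
  by rewrite -/(h x) mem_enum inE => /andP[? /eqP].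
exists h; split=> // x y xA yA hxy.
have fxy : f x = f y by rewrite -(hP x xA).2 -(hP y yA).2 hxy.
move: hxy (szE x xA) (szE y yA); rewrite /h fxy => /eqP + sx sy.
rewrite nth_uniq ?enum_uniq // => /eqP.
by apply: (index_inj x (s := eA (f y))); rewrite mem_enum inE ?xA ?fxy ?yA eqxx.
Qed.

(** * Conjugations that preserve cycle minima *)

Section Conjugation.
Variable n : nat.
Implicit Types (d s : 'S_n) (Th Sg : perm3 n).

Definition min_conj d1 d2 s :=
  (forall i, s (d1 i) = d2 (s i)) /\
  (forall i, (s i \in Smin d2) = (i \in Smin d1)).

Lemma min_conjV d1 d2 s : min_conj d1 d2 s -> min_conj d2 d1 s^-1%g.
Proof.
move=> [sd sm]; split=> i; last by rewrite -sm permKV.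
by apply: (@perm_inj _ s); rewrite sd !permKV.
Qed.

Lemma min_conjX d1 d2 s t i :
  min_conj d1 d2 s -> s ((d1 ^+ t)%g i) = (d2 ^+ t)%g (s i).
Proof. by move=> [sd _]; elim: t => [|t IHt]; rewrite ?perm1// !expgSr !permM sd IHt. Qed.

Lemma min_conj_fix d1 d2 s i :
  min_conj d1 d2 s -> (s i \in fixpts d2) = (i \in fixpts d1).
Proof. by move=> [sd _]; rewrite !inE -sd (inj_eq perm_inj). Qed.

Lemma Smin_porbit_inj d i j :
  i \in Smin d -> j \in Smin d -> porbit d i = porbit d j -> i = j.
Proof.
rewrite !inE => /forall_inP mi /forall_inP mj eij.
apply/val_inj/eqP; rewrite eqn_leq mi ?mj ?eij ?porbit_id //.
by rewrite -eij porbit_id.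
Qed.

(** Each cycle has exactly one minimum, so [porbit d] maps the minima bijectively onto the
    cycles. *)
Lemma card_Smin_size d c :
  #|[set i in Smin d | #|porbit d i| == c]| = #|[set C in porbits d | #|C| == c]|.
Proof.
rewrite -(@card_in_imset _ _ (porbit d)); last first.
  move=> i j /[!in_set] /andP[mi _] /andP[mj _].
  by apply: Smin_porbit_inj; rewrite in_set.
apply: eq_card => C; rewrite inE; apply/imsetP/andP => [[i]|[]].
  by rewrite inE => /andP[_ ci] ->; split=> //; apply: imset_f.
move=> /imsetP[i _ ->] ci; have [t ti] := Smin_ex d i.
by exists ((d ^+ t)%g i); rewrite ?porbit_perm// inE ti porbit_perm.
Qed.

Lemma card_Smin_cycle_structure d1 d2 i0 :
  cycle_structure d1 = cycle_structure d2 ->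
  #|[set i in Smin d1 | #|porbit d1 i| == #|porbit d1 i0|]| =
  #|[set i in Smin d2 | #|porbit d2 i| == #|porbit d1 i0|]|.
Proof.
move=> cs; rewrite !card_Smin_size.
have c0 : 0 < #|porbit d1 i0| by rewrite lt0n card_porbit_neq0.
(* Tuple entries are counted from 0 and lengths from 1, so the entry to compare is at the
   predecessor of the length. *)
have cn : #|porbit d1 i0|.-1 < n.
  by rewrite prednK// -[leqRHS](card_ord n) max_card.
by have := congr1 (fun t => tnth t (Ordinal cn)) cs; rewrite !tnth_mktuple /= prednK.
Qed.

(** A length-preserving matching [h] of the cycle minima is extended along the cycles: the [k]-th
    [d1]-iterate of a minimum goes to the [k]-th [d2]-iterate of its image under [h]. *)
Lemma cycle_structure_min_conj d1 d2 :
  cycle_structure d1 = cycle_structure d2 -> exists s, min_conj d1 d2 s.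
Proof.
(* The default [y0] for the matching requires a point; on an empty ['I_n] the identity works
   vacuously. *)
case: (pickP 'I_n) => [y0 _|n0]; last first.
  by move=> _; exists 1%g; split=> i; have := n0 i.
move=> cs.
have [h [h_inj hP]] := @exists_inj_on _ _ _ (Smin d1) (Smin d2)
  (fun i => #|porbit d1 i|) (fun i => #|porbit d2 i|) y0
  (fun i _ => card_Smin_cycle_structure i cs).
have reach i : exists mk : 'I_n * nat,
    (mk.1 \in Smin d1) && ((d1 ^+ mk.2)%g mk.1 == i).
  have [t ti] := Smin_ex d1 i; set m := (d1 ^+ t)%g i in ti.
  have /porbitP[k ik] : i \in porbit d1 m by rewrite porbit_sym mem_porbit.
  by exists (m, k); rewrite ti /= -ik eqxx.
pose mk i := xchoose (reach i); pose m i := (mk i).1; pose k i := (mk i).2.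
have mP i : m i \in Smin d1 by case/andP: (xchooseP (reach i)).
have kP i : (d1 ^+ k i)%g (m i) = i by case/andP: (xchooseP (reach i)) => _ /eqP.
pose f i := (d2 ^+ k i)%g (h (m i)).
(* The chosen exponent [k i] is immaterial: two valid choices agree modulo the length that the
   cycles of [j] and [h j] share. *)
have fE j a : j \in Smin d1 -> f ((d1 ^+ a)%g j) = (d2 ^+ a)%g (h j).
  move=> jm; set i := (d1 ^+ a)%g j.
  have mj : m i = j.
    apply: (@Smin_porbit_inj d1) => //.
    by rewrite -(porbit_perm _ (k i) (m i)) kP porbit_perm.
  rewrite /f mj; apply/eqP; rewrite permX_eq_mod (hP j jm).2 -permX_eq_mod.
  by rewrite -{1}mj kP.
have f_inj : injective f.
  (* Equal images lie on one cycle of [d2], which has a single minimum; injectivity of [h] then puts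
     [i] and [j] on the same cycle of [d1], and their exponents agree modulo its length. *)
  move=> i j fij; have hij : h (m i) = h (m j).
    apply: (@Smin_porbit_inj d2); rewrite ?(hP _ (mP _)).1//.
    by rewrite -(porbit_perm _ (k i)) -[in RHS](porbit_perm _ (k j)) -/(f i) fij.
  have mij := h_inj _ _ (mP i) (mP j) hij.
  move: fij; rewrite /f -mij => /eqP.
  rewrite permX_eq_mod (hP _ (mP i)).2 -permX_eq_mod => /eqP.
  by rewrite kP mij kP.
exists (perm f_inj); split=> i; rewrite !permE.
  by rewrite -[in LHS](kP i) -permM -expgSr fE ?mP// expgSr permM.
apply/idP/idP => [fi|im]; last first.
  by have := fE i 0 im; rewrite !perm1 => ->; rewrite (hP i im).1.
(* If [f i] is a minimum, it is the minimum [h (m i)] of its cycle; hence [k i] is 0 modulo the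
   length and [i] is [m i]. *)
have /eqP : f i = h (m i).
  by apply: (Smin_porbit_inj fi); rewrite ?porbit_perm// (hP _ (mP i)).1.
rewrite -[h _]perm1 -[1%g](expg0 d2) permX_eq_mod (hP _ (mP i)).2 -permX_eq_mod.
by rewrite perm1 kP => /eqP ->.
Qed.

(** * Conjugation of triples of permutations *)

Definition min_conj3 Th1 Th2 Sg :=
  [/\ min_conj Th1.1.1 Th2.1.1 Sg.1.1, min_conj Th1.1.2 Th2.1.2 Sg.1.2
    & min_conj Th1.2 Th2.2 Sg.2].

Definition inv3 Sg : perm3 n := (Sg.1.1^-1, Sg.1.2^-1, Sg.2^-1)%g.

Lemma min_conj3V Th1 Th2 Sg : min_conj3 Th1 Th2 Sg -> min_conj3 Th2 Th1 (inv3 Sg).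
Proof. by case=> *; split; apply: min_conjV. Qed.

Lemma act3K Sg : cancel (act3 Sg) (act3 (inv3 Sg)).
Proof. by case=> [[i j] k]; rewrite /act3 /= !permK. Qed.

Lemma act3KV Sg : cancel (act3 (inv3 Sg)) (act3 Sg).
Proof. by case=> [[i j] k]; rewrite /act3 /= !permKV. Qed.

Lemma exists_min_conj3 Th1 Th2 :
  cycle_structure3 Th1 = cycle_structure3 Th2 -> exists Sg, min_conj3 Th1 Th2 Sg.
Proof.
move=> cs; have [a aP] := cycle_structure_min_conj (congr1 (fun l => l.1.1) cs).
have [b bP] := cycle_structure_min_conj (congr1 (fun l => l.1.2) cs).
have [c cP] := cycle_structure_min_conj (congr1 (fun l => l.2) cs).
by exists (a, b, c).
Qed.

(** * Transport of the index sets and of the solution sets *)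

Section Transport.
Variables (Th1 Th2 Sg : perm3 n).
Hypothesis SgP : min_conj3 Th1 Th2 Sg.

Let aP : min_conj Th1.1.1 Th2.1.1 Sg.1.1. Proof. by case: SgP. Qed.
Let bP : min_conj Th1.1.2 Th2.1.2 Sg.1.2. Proof. by case: SgP. Qed.
Let cP : min_conj Th1.2 Th2.2 Sg.2. Proof. by case: SgP. Qed.

Lemma act3_conj t : act3 Sg (act3 Th1 t) = act3 Th2 (act3 Sg t).
Proof. by rewrite /act3 /= aP.1 bP.1 cP.1. Qed.

Lemma STh_conj i j : ((Sg.1.1 i, Sg.1.2 j) \in STh Th2) = ((i, j) \in STh Th1).
Proof. by rewrite in_set [RHS]in_set /= (min_conj_fix _ aP) aP.2 bP.2. Qed.

Lemma SFix_conj t : (act3 Sg t \in SFix Th2) = (t \in SFix Th1).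
Proof.
by case: t => [[i j] k]; rewrite !mem_SFix /= !(min_conj_fix _ aP)
  !(min_conj_fix _ bP) !(min_conj_fix _ cP).
Qed.

Lemma index_set_conj t : (act3 Sg t \in index_set Th2) = (t \in index_set Th1).
Proof.
by case: t => [[i j] k]; rewrite !in_setD SFix_conj !in_setX STh_conj !in_setT.
Qed.

(** Both sides are minima over the same set of exponents, by [STh_conj]. *)
Lemma mTh_conj i j : mTh Th2 (Sg.1.1 i) (Sg.1.2 j) = mTh Th1 i j.
Proof.
by apply: eq_ex_minn => t; rewrite -(min_conjX _ _ aP) -(min_conjX _ _ bP) STh_conj.
Qed.

Lemma repTh_conj t : repTh Th2 (act3 Sg t) = act3 Sg (repTh Th1 t).
Proof.
by rewrite /repTh mTh_conj /act3 /= (min_conjX _ _ aP) (min_conjX _ _ bP) (min_conjX _ _ cP).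
Qed.

(** Points are pulled back from [Th2] to [Th1]: each line sum is reindexed along one component of
    [Sg], and invariance follows from [act3_conj]. *)
Lemma FS_conj (x : {ffun triple n -> bool}) :
  x \in FS Th2 -> [ffun t => x (act3 Sg t)] \in FS Th1.
Proof.
rewrite !in_set => /and4P[/'forall_forallP x1 /'forall_forallP x2 /'forall_forallP x3 /forallP x4].
apply/and4P; split.
- apply/'forall_forallP => j k; have /eqP <- := x1 (Sg.1.2 j) (Sg.2 k).
  rewrite [eqbRHS](reindex_inj (@perm_inj _ Sg.1.1)).
  by apply/eqP/eq_bigr => i _; rewrite ffunE.
- apply/'forall_forallP => i k; have /eqP <- := x2 (Sg.1.1 i) (Sg.2 k).
  rewrite [eqbRHS](reindex_inj (@perm_inj _ Sg.1.2)).
  by apply/eqP/eq_bigr => j _; rewrite ffunE.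
- apply/'forall_forallP => i j; have /eqP <- := x3 (Sg.1.1 i) (Sg.1.2 j).
  rewrite [eqbRHS](reindex_inj (@perm_inj _ Sg.2)).
  by apply/eqP/eq_bigr => k _; rewrite ffunE.
by apply/forallP => t; rewrite !ffunE act3_conj.
Qed.

Lemma coord_conj_proof (u : FS'_coord Th1) : act3 Sg (val u) \in index_set Th2.
Proof. by rewrite index_set_conj (valP u). Qed.

Definition coord_conj (u : FS'_coord Th1) : FS'_coord Th2 :=
  exist _ (act3 Sg (val u)) (coord_conj_proof u).

Lemma xval_conj (x : {ffun FS'_coord Th2 -> bool}) t :
  xval [ffun u => x (coord_conj u)] t = xval x (act3 Sg t).
Proof.
(* Outside the index sets, which correspond under [act3 Sg], both sides take the default value
   [false]. *)
rewrite /xval; case: insubP => [u _ ut|]; last first.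
  by rewrite -index_set_conj; case: insubP => // u ->.
by rewrite ffunE (_ : insub _ = Some (coord_conj u))// -ut -[act3 _ _]/(val (coord_conj u)) valK.
Qed.

Lemma FS'_conj (x : {ffun FS'_coord Th2 -> bool}) :
  x \in FS' Th2 -> [ffun u => x (coord_conj u)] \in FS' Th1.
Proof.
rewrite !in_set => /and3P[/'forall_forallP x1 /'forall_forallP x2 /'forall_forallP x3].
apply/and3P; split.
- apply/'forall_forallP => j k; have /eqP <- := x1 (Sg.1.2 j) (Sg.2 k).
  (* The ranges of summation correspond by [SFix_conj], the summands by [repTh_conj]. *)
  rewrite [eqbRHS](reindex_inj (@perm_inj _ Sg.1.1)); apply/eqP/eq_big => i.
    by rewrite !in_setC in_set [in RHS]in_set -(SFix_conj (i, j, k)).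
  by rewrite xval_conj -repTh_conj.
- apply/'forall_forallP => i k; have /eqP <- := x2 (Sg.1.1 i) (Sg.2 k).
  rewrite [eqbRHS](reindex_inj (@perm_inj _ Sg.1.2)); apply/eqP/eq_big => j.
    by rewrite !in_setC in_set [in RHS]in_set -(SFix_conj (i, j, k)).
  by rewrite xval_conj -repTh_conj.
- apply/'forall_forallP => i j; have /eqP <- := x3 (Sg.1.1 i) (Sg.1.2 j).
  rewrite [eqbRHS](reindex_inj (@perm_inj _ Sg.2)); apply/eqP/eq_big => k.
    by rewrite !in_setC in_set [in RHS]in_set -(SFix_conj (i, j, k)).
  by rewrite xval_conj -repTh_conj.
Qed.

End Transport.

Lemma coord_conjK Th1 Th2 Sg (SgP : min_conj3 Th1 Th2 Sg) :
  cancel (coord_conj SgP) (coord_conj (min_conj3V SgP)).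
Proof. by move=> u; apply: val_inj; rewrite /= act3K. Qed.

Lemma coord_conjKV Th1 Th2 Sg (SgP : min_conj3 Th1 Th2 Sg) :
  cancel (coord_conj (min_conj3V SgP)) (coord_conj SgP).
Proof. by move=> u; apply: val_inj; rewrite /= act3KV. Qed.

End Conjugation.

(** * Convex hulls under a bijection of coordinates *)

Section Reindexing.
Variable R : realType.
Local Open Scope classical_set_scope.
Local Open Scope ring_scope.

Lemma reindexK (I J : finType) (f : J -> I) (g : I -> J) :
  cancel g f -> cancel (@reindex R I J f) (reindex g).
Proof. by move=> gK x; apply/ffunP => i; rewrite !ffunE gK. Qed.

Lemma reindex_conv01_sub (I J : finType) (f : J -> I)
    (V : {set {ffun I -> bool}}) (W : {set {ffun J -> bool}}) :
  (forall x, x \in V -> [ffun j => x (f j)] \in W) ->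
  reindex f @` @conv01 R _ V `<=` @conv01 R _ W.
Proof.
move=> VW _ [x xV <-] C [cC WC].
(* As [reindex f] is linear, the preimage of the convex set [C] is convex; it contains the vertices
   from [V], hence their hull. *)
suff : (reindex f @^-1` C) x by [].
apply: xV; split.
  move=> y z l /set_mem yC /set_mem zC; apply/mem_set.
  have /set_mem := cC _ _ l (mem_set yC) (mem_set zC).
  by congr (C _); apply/ffunP => j; rewrite !ffunE.
move=> _ [y yV <-]; apply: WC; exists [ffun j => y (f j)]; first exact: VW.
by apply/ffunP => j; rewrite !ffunE.
Qed.

Lemma equiv01_conv01 (I J : finType) (f : J -> I) (g : I -> J)
    (V : {set {ffun I -> bool}}) (W : {set {ffun J -> bool}}) :
  cancel f g -> cancel g f ->
  (forall x, x \in V -> [ffun j => x (f j)] \in W) ->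
  (forall y, y \in W -> [ffun i => y (g i)] \in V) ->
  equiv01 (@conv01 R _ V) (@conv01 R _ W).
Proof.
move=> fK gK VW WV; exists f; first by exists g.
suff -> : reindex f @` @conv01 R _ V = @conv01 R _ W by apply: rt_refl.
apply/seteqP; split; first exact: reindex_conv01_sub.
move=> y yW; exists (reindex g y); last exact: reindexK.
by apply: (reindex_conv01_sub WV); exists y.
Qed.

End Reindexing.

Theorem theorem3p3 (R : realType) (n : nat)
    (l : n.-tuple nat * n.-tuple nat * n.-tuple nat)
    (hl : exists2 Th : perm3 n, Th \in autotopisms n & cycle_structure3 Th = l)
    (Th1 Th2 : perm3 n)
    (hTh1 : Th1 \in autotopisms n) (hl1 : cycle_structure3 Th1 = l)
    (hTh2 : Th2 \in autotopisms n) (hl2 : cycle_structure3 Th2 = l) :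
  equiv01 (P_LS R Th1) (P_LS R Th2) /\ equiv01 (P'_LS R Th1) (P'_LS R Th2).
Proof.
have [s sP] := exists_min_conj3 (etrans hl1 (esym hl2)).
split.
  (* The coordinate bijection runs from [Th2] back to [Th1], so it is the inverse of [s] that
     reindexes. *)
  apply: (equiv01_conv01 R (@act3KV _ s) (@act3K _ s)) => x; last exact: FS_conj.
  exact: (FS_conj (min_conj3V sP)).
apply: (equiv01_conv01 R (coord_conjKV sP) (coord_conjK sP)) => x; exact: FS'_conj.
Qed.
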